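(* Let $(\mathbb{X},d_{\mathbb{X}})$ and $(\mathbb{Y},d_{\mathbb{Y}})$ be two Polish spaces, where $\mathbb{Y}\subseteq\mathbb{R}^k$ ($k\ge 1$) and $d_{\mathbb{Y}}(y,\tilde y)=\|y-\tilde y\|_2$ with $\|\cdot\|_2$ the Euclidean norm. Let $X$ be a random variable taking values in $\mathbb{X}$ with law $\nu$, where $\nu\in\mathbb{P}_1(\mathbb{X})$ is a Borel probability measure on $(\mathbb{X},d_{\mathbb{X}})$, and let $\sigma>0$. Suppose that $$W_1(\mu,\nu)\le\sqrt{2\sigma^2 D(\mu\|\nu)}\qquad\text{for all }\mu\in\mathbb{P}_1(\mathbb{X}).$$ Then for every $\epsilon>0$, every $\varepsilon\in(0,1]$, and every Lipschitz map $f:(\mathbb{X},d_{\mathbb{X}})\to(\mathbb{Y},\|\cdot\|_2)$ with Lipschitz constant $\|f\|_{\rm Lip}>0$ and with $\|E_\nu[f]\|_\infty<\infty$, $$P\big(\|f(X)-E_\nu[f(X)]\|_2\ge\epsilon\big)\le\min\left\{\left(1+\frac{2}{\varepsilon}\right)^k e^{-\frac{\epsilon^2(1-\varepsilon)^2}{2\sigma^2\|f\|_{\rm Lip}^2}},\ 2^{\frac{k}{2}}e^{-\frac{\epsilon^2}{4\sigma^2\|f\|_{\rm Lip}^2}}\right\}.$$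
   Context: A map $f:\mathbb{X}\to\mathbb{Y}$ is Lipschitz with Lipschitz constant $\|f\|_{\rm Lip}$ if $d_{\mathbb{Y}}(f(x),f(\tilde x))\le\|f\|_{\rm Lip}\,d_{\mathbb{X}}(x,\tilde x)$ for all $x,\tilde x\in\mathbb{X}$. $\mathbb{P}_1(\mathbb{X})$ is the set of Borel probability measures $\rho$ on $\mathbb{X}$ such that $E_\rho[d_{\mathbb{X}}(X,x_0)]<\infty$ for some (equivalently every) $x_0\in\mathbb{X}$. For $\rho,\tilde\rho\in\mathbb{P}_1(\mathbb{X})$ the $L^1$ Wasserstein distance is $W_1(\rho,\tilde\rho)=\inf_{\gamma\in\Pi(\rho,\tilde\rho)}\int_{\mathbb{X}\times\mathbb{X}}d_{\mathbb{X}}(x,\tilde x)\,\gamma(dx,d\tilde x)$, where $\Pi(\rho,\tilde\rho)$ is the set of couplings of $\rho$ and $\tilde\rho$ (probability measures on $\mathbb{X}\times\mathbb{X}$ with marginals $\rho,\tilde\rho$). The relative entropy is $D(\mu\|\nu)=E_\mu\left[\log\frac{d\mu}{d\nu}\right]$ if $\mu\ll\nu$, and $D(\mu\|\nu)=\infty$ otherwise (natural logarithm). $E_\nu[f]=E_\nu[f(X)]\in\mathbb{R}^k$ is the coordinatewise expectation of $f(X)$ with $X\sim\nu$ (it need not lie in $\mathbb{Y}$), and $\|\cdot\|_\infty$ is the maximum norm on $\mathbb{R}^k$. *)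

(* Defs.v *)
From HB Require Import structures.
From mathcomp Require Import all_boot all_order all_algebra.
From mathcomp Require Import all_classical all_reals all_analysis.
From mathcomp Require Import ring.

Set Implicit Arguments.
Unset Strict Implicit.
Unset Printing Implicit Defensive.

Import Order.TTheory GRing.Theory Num.Theory.
Import numFieldNormedType.Exports.

Local Open Scope classical_set_scope.
Local Open Scope ring_scope.

(* [pointedType] is only there because [measurableType] inherits from it. *)
#[short(type="pointedMetricType")]
HB.structure Definition PointedMetric (R : numDomainType) :=
  {T of Pointed T & Metric R T}.

(* Complete separable metric space.  Completeness is [cauchy_cvg] of
   [completeType], with an explicit limit so that [T] need not be pointed. *)
Definition polish (R : realType) (T : metricType R) : Prop :=
  (forall F : set_system T, ProperFilter F -> cauchy F ->
     exists l : T, F --> l) /\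
  (exists D : set T, countable D /\ dense D).

Notation borel T := (g_sigma_algebraType (@open T)).

Definition lipschitz_with (R : realType) (T U : metricType R) (L : R)
    (f : T -> U) : Prop :=
  forall x x' : T, mdist (f x) (f x') <= L * mdist x x'.

Section wasserstein_entropy.
Context {R : realType} {T : pointedMetricType R}.
Implicit Types mu nu rho : probability (borel T) R.
Local Open Scope ereal_scope.
Local Open Scope charge_scope.

Definition finite_first_moment rho : Prop :=
  exists x0 : T, \int[rho]_(x in [set: borel T]) (mdist (x : T) x0)%:E < +oo.

(* On separable [T] the Borel sigma-algebra of [T * T] is the product one.
   Marginals are compared on measurable sets only, since a measure is a function
   on all subsets whose values outside the sigma-algebra are irrelevant. *)
Definition coupling rho rho'
    (gamma : probability (borel T * borel T)%type R) : Prop :=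
  forall A : set (borel T), measurable A ->
    pushforward gamma fst A = rho A /\ pushforward gamma snd A = rho' A.

Definition wasserstein1 rho rho' : \bar R :=
  ereal_inf [set \int[gamma]_(z in [set: borel T * borel T])
                    (mdist (z.1 : T) (z.2 : T))%:E
            | gamma in [set gamma | coupling rho rho' gamma]].

(* The negative part of [lne (dmu/dnu)] is always [mu]-integrable, so the
   integral never has the indeterminate form [+oo - +oo]. *)
Definition relative_entropy mu nu : \bar R :=
  if `[< mu `<< nu >] then
    \int[mu]_(x in [set: borel T])
       lne ('d (charge_of_finite_measure mu) '/d nu x)
  else +oo.

End wasserstein_entropy.

Definition norm2 (R : realType) (k : nat) (v : 'rV[R]_k) : R :=
  Num.sqrt (\sum_(i < k) v ord0 i ^+ 2).

Section norm2_theory.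
Context {R : realType} {k : nat}.
Implicit Types u v : 'rV[R]_k.

Lemma norm2_ge0 v : 0 <= norm2 v.
Proof. exact: sqrtr_ge0. Qed.

Lemma norm2_sqr v : norm2 v ^+ 2 = \sum_(i < k) v ord0 i ^+ 2.
Proof. by rewrite sqr_sqrtr// sumr_ge0// => i _; rewrite sqr_ge0. Qed.

Lemma norm2_0 : norm2 (0 : 'rV[R]_k) = 0.
Proof. by rewrite /norm2 big1 ?sqrtr0// => i _; rewrite mxE expr0n. Qed.

Lemma norm2_eq0 v : norm2 v = 0 -> v = 0.
Proof.
move=> v0; have := norm2_sqr v; rewrite v0 expr0n/= => /esym/eqP.
rewrite psumr_eq0; last by move=> i _; rewrite sqr_ge0.
move=> /allP v_0; apply/rowP => i; rewrite mxE.
by have := v_0 i; rewrite mem_index_enum/= sqrf_eq0 => /(_ isT)/eqP.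
Qed.

Lemma norm2N v : norm2 (- v) = norm2 v.
Proof. by congr Num.sqrt; apply: eq_bigr => i _; rewrite mxE sqrrN. Qed.

Lemma sum_mul_le_norm2 u v :
  \sum_(i < k) u ord0 i * v ord0 i <= norm2 u * norm2 v.
Proof.
have [->|u0] := eqVneq u 0.
  by rewrite norm2_0 mul0r big1// => i _; rewrite mxE mul0r.
have [->|v0] := eqVneq v 0.
  by rewrite norm2_0 mulr0 big1// => i _; rewrite mxE mulr0.
have pos (w : 'rV[R]_k) : w != 0 -> 0 < norm2 w.
  move=> w0; rewrite lt0r norm2_ge0 andbT.
    by apply: contra_neq w0 => /norm2_eq0.
have a0 := pos _ u0; have b0 := pos _ v0.
set a := norm2 u in a0 *; set b := norm2 v in b0 *.
have : 0 <= \sum_(i < k) (b * u ord0 i - a * v ord0 i) ^+ 2.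
  by apply: sumr_ge0 => i _; rewrite sqr_ge0.
have -> : \sum_(i < k) (b * u ord0 i - a * v ord0 i) ^+ 2 =
    b ^+ 2 * (\sum_(i < k) u ord0 i ^+ 2) + a ^+ 2 * (\sum_(i < k) v ord0 i ^+ 2)
    - 2 * (a * b) * \sum_(i < k) u ord0 i * v ord0 i.
  rewrite !mulr_sumr -sumrN -!big_split/=.
  by apply: eq_bigr => i _; ring.
rewrite -!norm2_sqr -/a -/b subr_ge0 => h.
have ab0 : 0 < 2 * (a * b) by rewrite mulr_gt0// mulr_gt0.
rewrite -(ler_pM2l ab0); apply: (le_trans h).
by rewrite le_eqVlt; apply/orP; left; apply/eqP; ring.
Qed.

Lemma norm2D u v : norm2 (u + v) <= norm2 u + norm2 v.
Proof.
rewrite -(@ler_pXn2r _ 2)// ?nnegrE ?addr_ge0 ?norm2_ge0//.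
rewrite sqrrD !norm2_sqr.
have -> : \sum_(i < k) (u + v) ord0 i ^+ 2 =
    \sum_(i < k) u ord0 i ^+ 2 +
    (\sum_(i < k) u ord0 i * v ord0 i) *+ 2 + \sum_(i < k) v ord0 i ^+ 2.
  rewrite -sumrMnl -!big_split/=; apply: eq_bigr => i _.
  by rewrite mxE sqrrD.
by rewrite lerD2r lerD2l lerMn2r/= sum_mul_le_norm2.
Qed.

End norm2_theory.

(* The subset [Y] of R^k as a metric space of its own; the alias of [set_type Y]
   keeps it apart from the library's topology, which uses the maximum norm. *)
Definition euclidean_subspace (R : realType) (k : nat) (Y : set 'rV[R]_k) : Type :=
  set_type Y.

Section euclidean_subspace_metric.
Context {R : realType} {k : nat} {Y : set 'rV[R]_k}.
Implicit Types y : euclidean_subspace Y.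

Definition vec y : 'rV[R]_k := set_val (y : set_type Y).

Definition euclidean_dist y y' : R := norm2 (vec y - vec y').

Let distxx y : euclidean_dist y y = 0.
Proof. by rewrite /euclidean_dist subrr norm2_0. Qed.

Let dist_positivity y y' : euclidean_dist y y' = 0 -> y = y'.
Proof. by move=> /norm2_eq0/eqP; rewrite subr_eq0 => /eqP/val_inj. Qed.

Let dist_sym y y' : euclidean_dist y y' = euclidean_dist y' y.
Proof. by rewrite /euclidean_dist -norm2N opprB. Qed.

Let dist_triangle y' y y'' :
  euclidean_dist y y'' <= euclidean_dist y y' + euclidean_dist y' y''.
Proof.
rewrite /euclidean_dist; apply: le_trans (norm2D _ _).
by rewrite addrA subrK.
Qed.

HB.instance Definition _ := Choice.copy (euclidean_subspace Y) (set_type Y).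
HB.instance Definition _ := @isMetric.Build R (euclidean_subspace Y)
  euclidean_dist distxx dist_positivity dist_sym dist_triangle.

End euclidean_subspace_metric.

Section vector_expectation.
Context d {T : measurableType d} {R : realType} {k : nat}.
Local Open Scope ereal_scope.

Definition expectation_vec (nu : probability T R) (g : T -> 'rV[R]_k) :
    'rV[\bar R]_k :=
  \row_(i < k) 'E_nu[fun x => g x ord0 i].

Definition norm_max (m : 'rV[\bar R]_k) : \bar R :=
  \big[maxe/0]_(i < k) `|m ord0 i|.

End vector_expectation.

(* Main.v *)
From HB Require Import structures.
Require Import Defs.
From mathcomp Require Import all_boot all_order all_algebra.
From mathcomp Require Import all_classical all_reals all_analysis.
From mathcomp Require Import measurable_realfun ring lra.
Import Order.TTheory GRing.Theory Num.Theory.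
Import numFieldNormedType.Exports.

(** The transport inequality gives the Bobkov-Goetze bound on exponential
    moments.  If [g] is bounded, [L]-Lipschitz and normalised by
    [E_nu (exp g) = 1], let [mu = exp g . nu]; then [D(mu || nu) = E_mu g], and
    testing [W_1] against [g] yields
    [E_mu g - E_nu g <= L sqrt (2 sigma^2 E_mu g)
                     <= E_mu g + L^2 sigma^2 / 2],
    so [E_nu g + L^2 sigma^2 / 2 >= 0], which bounds the log-Laplace transform.
    Truncation and Fatou's lemma remove boundedness.

    With [Z = f - E_nu f] and [s = sigma L], this makes
    [E exp <theta, Z> <= exp (s^2 |theta|^2 / 2)] for every [theta].
    Averaging over a centred Gaussian [theta] of variance [a / s^2] gives
    [E exp (a |Z|^2 / (2 s^2)) <= (1 - a)^(-k/2)], hence by Markov's inequality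
    [P (|Z| >= r) <= (1 - a)^(-k/2) exp (- a r^2 / (2 s^2))] for [0 < a < 1].
    The second bound is the case [a = 1/2]; the first one follows, without any
    covering argument, from [a = (1 - veps)^2] because
    [1 / (veps (2 - veps)) <= (1 + 2 / veps)^2]. *)

Set Implicit Arguments.
Unset Strict Implicit.
Unset Printing Implicit Defensive.

Local Open Scope classical_set_scope.
Local Open Scope ring_scope.

(** * Probabilities with a positive density *)

Section density.
Context d (T : measurableType d) (R : realType) (nu : probability T R).
Local Open Scope ereal_scope.
Local Open Scope charge_scope.

Lemma probability_with_density (h : T -> R) : measurable_fun setT h ->
    (forall x, 0 <= h x)%R -> \int[nu]_x (h x)%:E = 1 ->
  exists mu : probability T R,
    forall A, measurable A -> mu A = \int[nu]_(x in A) (h x)%:E.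
Proof.
move=> mh h0 h1; pose f A := \int[nu]_(x in A) (h x)%:E.
have f_0 : f set0 = 0 by rewrite /f integral_set0.
have f_ge0 A : 0 <= f A by apply: integral_ge0 => x _; rewrite lee_fin.
have f_sigma : semi_sigma_additive f.
  apply: semi_sigma_additive_nng_induced; first exact/measurable_EFinP.
  by move=> x; rewrite lee_fin.
pose mm := isMeasure.Build d T R f f_0 f_ge0 f_sigma.
pose m : {measure set T -> \bar R} := HB.pack f mm.
have m1 : m setT = 1 by [].
pose p : probability T R :=
  HB.pack f mm (Measure_isProbability.Build d T R m m1).
by exists p.
Qed.

Lemma bounded_integrable (g : T -> R) (M : R) : measurable_fun setT g ->
  (forall x, `|g x| <= M)%R -> nu.-integrable setT (EFin \o g).
Proof.
move=> mg gM; apply: (le_integrable measurableT _ _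
  (finite_measure_integrable_cst nu M measurableT)).
  exact/measurable_EFinP.
by move=> x _ /=; rewrite lee_fin (le_trans (gM x))// ler_norm.
Qed.

(** Finite values reduce [lne] to two branches, [-oo] on nonpositive values and the real [ln]
    elsewhere, each measurable. *)
Lemma measurable_lne (f : T -> \bar R) : (forall x, f x \is a fin_num) ->
  measurable_fun setT f -> measurable_fun setT (@lne R \o f).
Proof.
move=> ff mf0; rewrite (_ : _ \o _ = fun x =>
    if (fine (f x) <= 0)%R then -oo else (ln (fine (f x)))%:E); last first.
  by apply/funext => x /=; rewrite -{1}(fineK (ff x)).
apply: measurable_fun_ifT => //.
  by apply: measurable_fun_ler => //; exact: measurableT_comp.
apply/measurable_EFinP/measurableT_comp; first exact: measurable_ln.
exact: measurableT_comp.
Qed.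

Context (mu : probability T R) (h : T -> R).
Hypothesis mh : measurable_fun setT h.
Hypothesis h_gt0 : forall x, (0 < h x)%R.
Hypothesis muE : forall A, measurable A -> mu A = \int[nu]_(x in A) (h x)%:E.

Lemma density_dominates : mu `<< nu.
Proof.
apply/null_content_dominatesP => A mA nuA0; rewrite muE//.
by apply: null_set_integral => //; exact/measurable_funTS/measurable_EFinP.
Qed.

Let mf := @Radon_Nikodym_SigmaFinite.f_integrable _ _ _ mu nu density_dominates.

(** Uniqueness of densities: both functions integrate to [mu E] over every measurable [E]. *)
Let RN_density :
  ae_eq nu setT (Radon_Nikodym_SigmaFinite.f mu nu) (EFin \o h).
Proof.
apply: integral_ae_eq => //; first exact/measurable_EFinP.
move=> E _ mE; rewrite -muE//.
by rewrite (Radon_Nikodym_SigmaFinite.f_integral density_dominates mE).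
Qed.

Lemma integral_density (f : T -> \bar R) : measurable_fun setT f ->
  (forall x, 0 <= f x) -> \int[mu]_x f x = \int[nu]_x (f x * (h x)%:E).
Proof.
move=> mf0 f0.
rewrite -(Radon_Nikodym_SigmaFinite.change_of_variables density_dominates)//.
apply: ae_eq_integral => //.
- by apply: emeasurable_funM => //; exact: measurable_int mf.
- by apply: emeasurable_funM => //; exact/measurable_EFinP.
- exact/ae_eqe_mul2l/RN_density.
Qed.

(** Turns the relative entropy into an integral of the explicit function [ln h]. *)
Lemma integral_lne_density :
  \int[mu]_x lne ('d (charge_of_finite_measure mu) '/d nu x) =
  \int[mu]_x (ln (h x))%:E.
Proof.
have dom : charge_of_finite_measure mu `<< nu by exact: density_dominates.
apply: ae_eq_integral => //.
- apply: measurable_lne; first by move=> x; exact: Radon_Nikodym_fin_num.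
  exact: measurable_int (Radon_Nikodym_integrable dom).
- by apply/measurable_EFinP/measurableT_comp => //; exact: measurable_ln.
(* The derivative of a charge and that of a measure are distinct functions, equal only [nu]-almost
   everywhere. *)
- have : ae_eq nu setT ('d (charge_of_finite_measure mu) '/d nu) (EFin \o h).
    apply: ae_eq_trans RN_density.
    apply: ae_eq_sym.
    exact: (ae_eq_Radon_Nikodym_SigmaFinite density_dominates measurableT).
  (* The exceptional set is [nu]-null, hence [mu]-null by domination; off it, [h > 0] selects the
     real branch of [lne]. *)
  move=> [N [mN N0 NE]]; exists N; split => //.
    by move/null_content_dominatesP : density_dominates => /(_ N mN N0).
  apply: subset_trans NE => x /= + E; apply => _.
  by rewrite E//= leNgt h_gt0.
Qed.

End density.

(** * Real-valued Lipschitz functions and Borel measurability *)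

Section continuity.
Context {R : realType} {T : pointedMetricType R}.

(** One-sided form; exchanging [x] and [y] recovers the absolute value. *)
Definition lipschitz_real (L : R) (g : T -> R) :=
  forall x y : T, g x - g y <= L * mdist x y.

Lemma lipschitz_real_normr L g x y : lipschitz_real L g ->
  `|g x - g y| <= L * mdist x y.
Proof.
move=> Lg; rewrite ler_norml lerNl opprB Lg andbT.
by rewrite metric_sym Lg.
Qed.

Lemma lipschitz_real_continuous (L : R) (g : T -> R) :
  lipschitz_real L g -> continuous g.
Proof.
move=> Lg x; apply/cvgrPdist_lt => e e0.
(* No sign of [L] is assumed, so the radius is [e] divided by a quantity that is always positive. *)
have L1 : 0 < `|L| + 1 by rewrite ltr_wpDl.
near=> y.
have : ball x (e / (`|L| + 1)) y.
  by near: y; apply: nbhsx_ballx; rewrite divr_gt0.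
rewrite ballEmdist/= ltr_pdivlMr// => xy.
apply: le_lt_trans xy; rewrite (le_trans (lipschitz_real_normr _ _ Lg))//.
rewrite mulrC ler_wpM2l ?mdist_ge0//.
by rewrite (le_trans (ler_norm _))// lerDl.
Unshelve. all: by end_near. Qed.

Lemma continuous_borel_measurable (g : T -> R) :
  continuous g -> measurable_fun setT (g : borel T -> R).
Proof.
move=> /continuousP cg; apply: (measurability _ (RGenOpens.measurableE R)).
move=> _ [_ [a [b ->] <-]]; rewrite setTI; apply: sub_sigma_algebra.
exact/cg/interval_open.
Qed.

End continuity.

(** * Exponential moments of bounded Lipschitz functions *)

Section nonmeasurable_integrand.
Context d (T : measurableType d) (R : realType).
Context (mu : {measure set T -> \bar R}).
Local Open Scope ereal_scope.

(* [ge0_le_integral] without measurability: the integral of a nonnegative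
   function is a supremum over simple functions below it.  It spares us the
   joint measurability of [mdist]. *)
Lemma le_integral_nonmeasurable (f g : T -> \bar R) :
  (forall x, 0 <= f x) -> (forall x, f x <= g x) ->
  \int[mu]_x f x <= \int[mu]_x g x.
Proof.
move=> f0 fg; have g0 x : 0 <= g x by rewrite (le_trans (f0 x)).
rewrite !ge0_integralE// !patch_setT.
apply: ereal_sup_le => _ [h hf <-]; exists h => // x.
exact: le_trans (hf x) (fg x).
Qed.

End nonmeasurable_integrand.

(** * Tilting [nu] by the exponential of a bounded Lipschitz function *)

Section transport.
Context {R : realType} {T : pointedMetricType R}.
Implicit Types (mu nu : probability (borel T) R) (g : T -> R).

Lemma lipschitz_borel_measurable L g :
  lipschitz_real L g -> measurable_fun setT (g : borel T -> R).
Proof. by move/lipschitz_real_continuous/continuous_borel_measurable. Qed.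

Lemma lipschitz_mdist (x0 : T) : lipschitz_real 1 (fun x : T => mdist x x0).
Proof.
by move=> x y; rewrite mul1r lerBlDr metric_triangle.
Qed.

(** Each half of the integrand depends on one coordinate only, so its integral is determined by a
    marginal. *)
Lemma Rintegral_coupling_sub mu nu
    (gamma : probability (borel T * borel T)%type R) g M :
  coupling mu nu gamma -> measurable_fun setT (g : borel T -> R) ->
  (forall x, `|g x| <= M) ->
  \int[gamma]_z (g z.1 - g z.2) = \int[mu]_x g x - \int[nu]_x g x.
Proof.
move=> cpl mg gM.
have int1 : gamma.-integrable setT (EFin \o (fun z => g z.1)).
  apply: (@bounded_integrable _ _ _ _ _ M) => //.
  exact: (measurableT_comp mg measurable_fst).
have int2 : gamma.-integrable setT (EFin \o (fun z => g z.2)).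
  apply: (@bounded_integrable _ _ _ _ _ M) => //.
  exact: (measurableT_comp mg measurable_snd).
rewrite RintegralB//; congr (fine _ - fine _).
- rewrite [RHS](eq_measure_integral (pushforward gamma fst)); last first.
    by move=> A mA _; have [/esym ? /esym ?] := cpl _ mA.
  rewrite (integral_pushforward measurable_fst)//; first exact/measurable_EFinP.
- rewrite [RHS](eq_measure_integral (pushforward gamma snd)); last first.
    by move=> A mA _; have [/esym ? /esym ?] := cpl _ mA.
  rewrite (integral_pushforward measurable_snd)//; first exact/measurable_EFinP.
Qed.

(** The easy half of Kantorovich duality: the cost of every coupling dominates the difference of the
    means. *)
Lemma wasserstein1_ge mu nu g M : lipschitz_real 1 g ->
  (forall x, `|g x| <= M) ->
  ((\int[mu]_x g x - \int[nu]_x g x)%:E <= wasserstein1 mu nu)%E.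
Proof.
move=> Lg gM; apply: le_ereal_inf_tmp => _ [gamma cpl <-].
have mg := lipschitz_borel_measurable Lg.
rewrite -(Rintegral_coupling_sub cpl mg gM).
pose G (z : borel T * borel T) := g z.1 - g z.2.
have mG : measurable_fun setT G.
  apply: measurable_funB; first exact: (measurableT_comp mg measurable_fst).
  exact: (measurableT_comp mg measurable_snd).
have iG : gamma.-integrable setT (EFin \o G).
  apply: (@bounded_integrable _ _ _ _ _ (M + M)) => // z.
  by rewrite (le_trans (ler_normB _ _))// lerD.
rewrite /Rintegral fineK; last exact: integrable_fin_num.
(* The comparison without measurability needs a nonnegative lower function; the positive part of [G]
   is one, and it stays below the distance. *)
apply: (@le_trans _ _ (\int[gamma]_z (EFin \o G)^\+ z)%E).
  apply: le_integral => //; first exact: integrable_funepos.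
  by move=> z _; rewrite funeposE le_max lexx.
apply: le_integral_nonmeasurable => z /=.
  by rewrite funepos_ge0.
rewrite funeposE ge_max !lee_fin mdist_ge0 andbT.
by rewrite -[leRHS]mul1r Lg.
Qed.

Variables (nu : probability (borel T) R) (sigma : R).
Hypothesis sigma_gt0 : 0 < sigma.
Hypothesis nu_moment : finite_first_moment nu.
Hypothesis transport : forall mu, finite_first_moment mu ->
  (wasserstein1 mu nu <=
     sqrte ((2 * sigma ^+ 2)%:E * relative_entropy mu nu))%E.

Lemma bounded_normalized_transport L g M : 0 < L -> lipschitz_real L g ->
  (forall x, `|g x| <= M) -> (\int[nu]_x (expR (g x))%:E = 1)%E ->
  0 <= \int[nu]_x g x + L ^+ 2 * sigma ^+ 2 / 2.
Proof.
move=> L0 Lg gM g1.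
have mg := lipschitz_borel_measurable Lg.
have meg : measurable_fun setT (fun x : borel T => expR (g x)).
  exact: measurableT_comp.
have [mu muE] := probability_with_density meg (fun x => expR_ge0 _) g1.
have h0 (x : borel T) : 0 < expR (g x) by exact: expR_gt0.
(* The density is at most [expR M], so the first moment grows at most by that factor. *)
have mu_moment : finite_first_moment mu.
  have [x0 nu0] := nu_moment; exists x0.
  have md : measurable_fun setT (fun x : borel T => mdist (x : T) x0).
    exact: lipschitz_borel_measurable (@lipschitz_mdist x0).
  rewrite (integral_density meg muE); last 2 first.
  - exact/measurable_EFinP.
  - by move=> x; rewrite lee_fin mdist_ge0.
  apply: (@le_lt_trans _ _
    ((expR M)%:E * \int[nu]_x (mdist (x : T) x0)%:E)%E); last first.
    by rewrite lte_mul_pinfty// ?lee_fin ?expR_ge0//.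
  rewrite -ge0_integralZl_EFin ?expR_ge0//; last 2 first.
  - by move=> x _; rewrite lee_fin mdist_ge0.
  - exact/measurable_EFinP.
  apply: ge0_le_integral => //.
  - by move=> x _; rewrite -EFinM lee_fin mulr_ge0 ?mdist_ge0 ?expR_ge0.
  - by apply/measurable_EFinP; exact: measurable_funM.
  - by apply/measurable_EFinP; exact: measurable_funM.
  - move=> x _; rewrite -!EFinM lee_fin mulrC ler_wpM2r ?mdist_ge0// ler_expR.
    by rewrite (le_trans _ (gM x))// ler_norm.
have img : mu.-integrable setT (EFin \o (g : borel T -> R)).
  exact: (bounded_integrable _ mg gM).
set D := \int[mu]_x g x.
have entropyE : relative_entropy mu nu = D%:E.
  rewrite /relative_entropy ifT; last first.
    by apply/asboolP; exact: density_dominates meg muE.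
  rewrite (integral_lne_density meg h0 muE).
  under eq_integral do rewrite expRK.
  by rewrite /D /Rintegral fineK//; exact: integrable_fin_num.
(* [Num.sqrt] is [0] on negative reals, so [D >= 0] has to be known; it
   follows from [1 = E_mu (exp (- g)) >= 1 - E_mu g]. *)
have D0 : 0 <= D.
  have mN : measurable_fun setT (fun x : borel T => expR (- g x)).
    by apply: measurableT_comp => //; exact: measurable_funN.
  have EN : (\int[mu]_x (expR (- g x))%:E = 1)%E.
    rewrite (integral_density meg muE); last 2 first.
    - exact/measurable_EFinP.
    - by move=> x; rewrite lee_fin expR_ge0.
    under eq_integral do rewrite -EFinM -expRD addNr expR0.
    by rewrite integral_cst// [X in (_ * X)%E](@probability_setT _ _ _ nu)
      mule1.
  have : \int[mu]_x (1 - g x) <= \int[mu]_x (expR (- g x)).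
    apply: le_Rintegral => //.
    - apply: (@bounded_integrable _ _ _ _ _ (1 + M)).
        by apply: measurable_funB.
      by move=> x; rewrite (le_trans (ler_normB _ _))// normr1 lerD2l.
    - apply: (@bounded_integrable _ _ _ _ _ (expR M)) => // x.
      rewrite ger0_norm ?expR_ge0// ler_expR.
      by rewrite (le_trans (ler_norm _))// normrN.
    - by move=> x _; rewrite expR_ge1Dx.
  rewrite RintegralB//; last exact: (finite_measure_integrable_cst mu 1).
  rewrite Rintegral_cst// [X in _ * fine X]probability_setT mulr1.
  by rewrite [leRHS]/Rintegral EN/= -/D gerBl.
(* Rescaling produces a test function admissible for the lower bound on [wasserstein1]. *)
have Lg1 : lipschitz_real 1 (fun x => g x / L).
  move=> x y; rewrite mul1r -mulrBl ler_pdivrMr// mulrC.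
  exact: Lg.
have gM1 x : `|g x / L| <= M / L.
  by rewrite normrM normfV (gtr0_norm L0) ler_pM2r ?invr_gt0.
have := le_trans (wasserstein1_ge mu nu Lg1 gM1) (transport mu_moment).
rewrite entropyE -EFinM/= lee_fin.
rewrite !RintegralZr//; last exact: (bounded_integrable _ mg gM).
rewrite -/D -mulrBl ler_pdivrMr//.
set s := Num.sqrt _ => H.
have s2 : s ^+ 2 = 2 * sigma ^+ 2 * D.
  by rewrite sqr_sqrtr// mulr_ge0// mulr_ge0// sqr_ge0.
(* AM-GM: [L s <= L^2 sigma^2 / 2 + s^2 / (2 sigma^2)], with
   [D = s^2 / (2 sigma^2)]. *)
suff : s * L <= L ^+ 2 * sigma ^+ 2 / 2 + D by lra.
have -> : D = s ^+ 2 / (2 * sigma ^+ 2).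
  by rewrite s2 mulrAC divff ?mul1r// mulf_neq0// sqrf_eq0 gt_eqF.
rewrite -subr_ge0.
have -> : L ^+ 2 * sigma ^+ 2 / 2 + s ^+ 2 / (2 * sigma ^+ 2) - s * L =
  (L * sigma - s / sigma) ^+ 2 / 2 by field; rewrite gt_eqF.
by rewrite divr_ge0// sqr_ge0.
Qed.

(** Subtracting [c = ln Z] normalises the exponential moment without changing the Lipschitz
    constant; the normalised inequality then bounds [c]. *)
Lemma bounded_transport_mgf L g M : 0 < L -> lipschitz_real L g ->
  (forall x, `|g x| <= M) ->
  (\int[nu]_x (expR (g x))%:E <=
     (expR (\int[nu]_x g x + L ^+ 2 * sigma ^+ 2 / 2))%:E)%E.
Proof.
move=> L0 Lg gM.
have mg := lipschitz_borel_measurable Lg.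
have meg : measurable_fun setT (fun x : borel T => expR (g x)).
  exact: measurableT_comp.
have ieg : nu.-integrable setT (EFin \o (fun x : borel T => expR (g x))).
  apply: (@bounded_integrable _ _ _ _ _ (expR M)) => // x.
  by rewrite ger0_norm ?expR_ge0// ler_expR (le_trans (ler_norm _)).
have ig : nu.-integrable setT (EFin \o (g : borel T -> R)).
  exact: (bounded_integrable _ mg gM).
set Z := \int[nu]_x expR (g x).
have ZE : (\int[nu]_x (expR (g x))%:E = Z%:E)%E.
  by rewrite /Z /Rintegral fineK//; exact: integrable_fin_num.
(* Since [g >= - M]; positivity gives [expR (ln Z) = Z]. *)
have Z0 : 0 < Z.
  apply: (@lt_le_trans _ _ (\int[nu]_(x in [set: borel T]) expR (- M))).
    by rewrite Rintegral_cst// [X in _ * fine X]probability_setT mulr1 expR_gt0.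
  apply: le_Rintegral => //; first exact: finite_measure_integrable_cst.
  by move=> x _; rewrite ler_expR lerNl (le_trans (ler_norm _))// normrN.
pose c := ln Z.
have Lgc : lipschitz_real L (fun x => g x - c).
  by move=> x y; rewrite opprB addrA subrK Lg.
have gcM x : `|g x - c| <= M + `|c|.
  by rewrite (le_trans (ler_normB _ _))// lerD2r.
have gc1 : (\int[nu]_x (expR (g x - c))%:E = 1)%E.
  under eq_integral do rewrite expRD mulrC EFinM.
  rewrite ge0_integralZl_EFin ?expR_ge0//; last exact/measurable_EFinP.
  by rewrite ZE -EFinM expRN lnK ?posrE// mulVf ?gt_eqF.
have := bounded_normalized_transport L0 Lgc gcM gc1.
rewrite RintegralB//; last exact: (finite_measure_integrable_cst nu c).
rewrite Rintegral_cst// [X in _ * fine X]probability_setT mulr1 ZE lee_fin.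
by move=> H; rewrite -[leLHS]lnK ?posrE// ler_expR -/c; lra.
Qed.

End transport.

(** * Exponential moments of Lipschitz functions *)

Section unbounded.
Context {R : realType} {T : pointedMetricType R}.
Variables (nu : probability (borel T) R) (sigma : R).
Implicit Types (g : T -> R).
Hypothesis nu_moment : finite_first_moment nu.

(** Dominated by [|g x0| + |L| * mdist x x0], integrable by the first moment. *)
Lemma lipschitz_integrable L g : lipschitz_real L g ->
  nu.-integrable setT (EFin \o (g : borel T -> R)).
Proof.
move=> Lg; have mg := lipschitz_borel_measurable Lg.
have [x0 nu0] := nu_moment.
have md : measurable_fun setT (fun x : borel T => mdist (x : T) x0).
  exact: lipschitz_borel_measurable (@lipschitz_mdist _ _ x0).
have id : nu.-integrable setT (fun x : borel T => (mdist (x : T) x0)%:E).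
  apply/integrableP; split; first exact/measurable_EFinP.
  by under eq_integral do rewrite gee0_abs ?lee_fin ?mdist_ge0//.
apply: (le_integrable measurableT _ _ (integrableD measurableT
  (finite_measure_integrable_cst nu `|g x0| measurableT)
  (integrableZl measurableT `|L| id))); first exact/measurable_EFinP.
move=> x _ /=; rewrite lee_fin.
rewrite [leRHS]ger0_norm ?addr_ge0 ?mulr_ge0 ?mdist_ge0//.
rewrite -lerBlDl (le_trans (lerB_dist _ _))//.
rewrite (le_trans (lipschitz_real_normr _ _ Lg))//.
by rewrite ler_wpM2r ?mdist_ge0// ler_norm.
Qed.

Definition truncation (n : nat) (a : R) := Num.max (- n%:R) (Num.min a n%:R).

(** Truncation is monotone and does not increase gaps; [0 <= K] covers the case [a <= b]. *)
Lemma truncation_sub_le n a b K : a - b <= K -> 0 <= K ->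
  truncation n a - truncation n b <= K.
Proof.
move=> abK K0; have n0 : 0 <= n%:R :> R by [].
rewrite /truncation; move: n%:R n0 => N N0.
by case: (leP a N) => ?; case: (leP b N) => ?;
  do 2?[case: (leP (- N) _) => ?]; lra.
Qed.

Lemma truncation_bound n a : `|truncation n a| <= n%:R.
Proof.
rewrite ler_norml le_max lexx ge_max ge_min lexx orbT andbT /=.
by rewrite (@le_trans _ _ 0)// oppr_le0.
Qed.

Lemma truncation_le_norm n a : `|truncation n a| <= `|a|.
Proof.
have a0 : - `|a| <= 0 by rewrite oppr_le0.
have an : - `|a| <= n%:R by rewrite (le_trans a0).
have aa : - `|a| <= a by rewrite lerNl ler_normr lexx orbT.
rewrite ler_norml le_max le_min ge_max ge_min ler_norm aa an orbT andbT /=.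
by rewrite (@le_trans _ _ 0)// oppr_le0.
Qed.

Lemma truncation_id n a : `|a| <= n%:R -> truncation n a = a.
Proof.
rewrite ler_norml => /andP[na an].
by rewrite /truncation (min_idPl an) (max_idPr na).
Qed.

Lemma lipschitz_truncation L g n : 0 < L -> lipschitz_real L g ->
  lipschitz_real L (fun x => truncation n (g x)).
Proof.
by move=> L0 Lg x y; rewrite truncation_sub_le// mulr_ge0 ?mdist_ge0// ltW.
Qed.

Lemma cvg_truncation a : truncation n a @[n --> \oo] --> a.
Proof.
apply: cvg_near_cst; near=> n; apply: truncation_id.
by near: n; exact: nbhs_infty_ger.
Unshelve. all: by end_near. Qed.

Hypothesis sigma_gt0 : 0 < sigma.
Hypothesis transport : forall mu : probability (borel T) R,
  finite_first_moment mu ->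
  (wasserstein1 mu nu <=
     sqrte ((2 * sigma ^+ 2)%:E * relative_entropy mu nu))%E.

Lemma transport_mgf L g : 0 < L -> lipschitz_real L g ->
  (\int[nu]_x (expR (g x))%:E <=
     (expR (\int[nu]_x g x + L ^+ 2 * sigma ^+ 2 / 2))%:E)%E.
Proof.
move=> L0 Lg; set c := L ^+ 2 * sigma ^+ 2 / 2.
pose g_ n x := truncation n (g x).
have Lg_ n : lipschitz_real L (g_ n) by exact: lipschitz_truncation.
have mg_ n := lipschitz_borel_measurable (Lg_ n).
have ig := lipschitz_integrable Lg.
have bound n : (\int[nu]_x (expR (g_ n x))%:E <=
    (expR (\int[nu]_x g_ n x + c))%:E)%E.
  apply: (bounded_transport_mgf sigma_gt0 nu_moment transport L0 (Lg_ n)) => x.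
  exact: truncation_bound.
have limE x : limn_einf (fun n => (expR (g_ n x))%:E) = (expR (g x))%:E.
  suff /cvg_limn_einf_sup[] :
    (expR (g_ n x))%:E @[n --> \oo] --> (expR (g x))%:E by [].
  apply: cvg_EFin; first exact: nearW.
  apply: continuous_cvg; first exact: continuous_expR.
  exact: cvg_truncation.
(* Writing the integrand as a lower limit prepares Fatou's lemma. *)
under eq_integral do rewrite -limE.
have meg_ n : measurable_fun setT (fun x : borel T => (expR (g_ n x))%:E).
  by apply/measurable_EFinP; exact: measurableT_comp.
have eg_0 n (x : borel T) : setT x -> (0 <= (expR (g_ n x))%:E)%E.
  by rewrite lee_fin expR_ge0.
apply: le_trans (fatou nu measurableT meg_ eg_0) _.
(* Dominated convergence, with [|g|] as dominating function. *)
have cvg_mean : \int[nu]_x g_ n x @[n --> \oo] --> \int[nu]_x g x.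
  apply: fine_cvg; rewrite /Rintegral fineK; last exact: integrable_fin_num.
  apply: (@dominated_cvg _ _ _ nu setT measurableT _ _
    (fun x => `|(g x)%:E|)%E) => //.
  - by move=> n; exact/measurable_EFinP.
  - move=> x _; apply: cvg_EFin; first exact: nearW.
    exact: cvg_truncation.
  - exact: integrable_abse.
  - by move=> n x _; rewrite /= lee_fin truncation_le_norm.
have cvg_bound :
    (expR (\int[nu]_x g_ n x + c))%:E @[n --> \oo] -->
    (expR (\int[nu]_x g x + c))%:E.
  apply: cvg_EFin; first exact: nearW.
  apply: continuous_cvg; first exact: continuous_expR.
  by apply: cvgD => //; exact: cvg_cst.
(* The right-hand side becomes a lower limit too, so both are compared term by term through
   [bound]. *)
rewrite -(cvg_limn_einf_sup cvg_bound).
rewrite !limn_einf_lim; apply: lee_lim; [exact: is_cvg_einfs..|].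
apply: nearW => n; apply: le_ereal_inf_tmp => _ [m /= nm <-].
by apply: le_trans (bound m); apply: ereal_inf_lbound; exists m.
Qed.

End unbounded.

(** * Gaussian averaging of exponential moments *)

Section gaussian_mixture.
Context {R : realType}.
Local Notation leb := (@lebesgue_measure R).

(** Completing the square leaves a constant times the normal density of mean [tau ^+ 2 * z]. *)
Lemma integral_expR_normal_pdf (tau z : R) : 0 < tau ->
  (\int[leb]_t (expR (t * z) * normal_pdf 0 tau t)%:E =
     (expR (tau ^+ 2 / 2 * z ^+ 2))%:E)%E.
Proof.
move=> tau0; have tau_neq0 : tau != 0 by rewrite gt_eqF.
rewrite -[RHS]mule1 -(integral_normal_pdf (tau ^+ 2 * z) tau).
rewrite -ge0_integralZl_EFin ?expR_ge0//; last 2 first.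
- by move=> t _; rewrite lee_fin normal_pdf_ge0.
- by apply/measurable_EFinP; exact: measurable_normal_pdf.
apply: eq_integral => t _; rewrite -EFinM; congr EFin.
rewrite !normal_pdfE// /normal_fun mulrCA [RHS]mulrCA -!expRD.
by congr (_ * expR _); field. 
Qed.

(** With [q ^+ 2 = 1 - b * tau ^+ 2], the integrand is [q^-1] times the centred normal density of
    standard deviation [tau / q]. *)
Lemma integral_expR_sqr_normal_pdf (tau b : R) : 0 < tau ->
  b * tau ^+ 2 < 1 ->
  (\int[leb]_t (expR (b / 2 * t ^+ 2) * normal_pdf 0 tau t)%:E =
     (Num.sqrt (1 - b * tau ^+ 2))^-1%:E)%E.
Proof.
move=> tau0 b1; set q := Num.sqrt _.
have q0 : 0 < q by rewrite sqrtr_gt0 subr_gt0.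
have q2 : q ^+ 2 = 1 - b * tau ^+ 2 by rewrite sqr_sqrtr// subr_ge0 ltW.
have tau_neq0 : tau != 0 by rewrite gt_eqF.
have q_neq0 : q != 0 by rewrite gt_eqF.
rewrite -[RHS]mule1 -(integral_normal_pdf 0 (tau / q)).
rewrite -ge0_integralZl_EFin ?invr_ge0 ?(ltW q0)//; last 2 first.
- by move=> t _; rewrite lee_fin normal_pdf_ge0.
- by apply/measurable_EFinP; exact: measurable_normal_pdf.
apply: eq_integral => t _; rewrite -EFinM; congr EFin.
rewrite !normal_pdfE ?mulf_neq0 ?invr_eq0// /normal_fun mulrCA -expRD.
rewrite [RHS]mulrA; congr (_ * expR _).
  rewrite /normal_peak (_ : (tau / q) ^+ 2 * pi *+ 2 =
    q^-1 ^+ 2 * (tau ^+ 2 * pi *+ 2)); last first.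
    by rewrite exprMn [RHS]mulrnAr [in RHS]mulrCA mulrA.
  rewrite sqrtrM ?sqr_ge0// sqrtr_sqr ger0_norm ?invr_ge0 ?(ltW q0)//.
  by rewrite invfM invrK mulrA mulVf// mul1r.
rewrite expr_div_n q2; field.
by rewrite tau_neq0 -q2 expf_neq0.
Qed.

Context d (T : measurableType d) (nu : probability T R) (s : R).
Hypothesis s0 : 0 < s.

(** Integrate the hypothesis over a centred Gaussian [t] and exchange the integrals by Tonelli. [F]
    is a slot for the other coordinates. *)
Lemma gaussian_mixture1 (a K : R) (F Z : T -> R) : 0 < a -> a < 1 -> 0 <= K ->
  measurable_fun setT F -> measurable_fun setT Z ->
  (forall t, \int[nu]_x (expR (F x + t * Z x))%:E <=
             (K * expR (s ^+ 2 / 2 * t ^+ 2))%:E)%E ->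
  (\int[nu]_x (expR (F x + a / (2 * s ^+ 2) * Z x ^+ 2))%:E <=
     (K * (Num.sqrt (1 - a))^-1)%:E)%E.
Proof.
move=> a0 a1 K0 mF mZ FZ.
(* Chosen so that [tau ^+ 2 / 2] is the wanted coefficient [a / (2 * s ^+ 2)], while
   [s ^+ 2 * tau ^+ 2 = a < 1] keeps the right-hand integral finite. *)
pose tau := Num.sqrt a / s.
have tau0 : 0 < tau by rewrite divr_gt0 ?sqrtr_gt0.
have s_neq0 : s != 0 by rewrite gt_eqF.
have tau2 : tau ^+ 2 = a / s ^+ 2 by rewrite expr_div_n sqr_sqrtr ?ltW.
pose f (z : T * R) : \bar R :=
  (expR (F z.1 + z.2 * Z z.1) * normal_pdf 0 tau z.2)%:E.
have mf : measurable_fun setT f.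
  apply/measurable_EFinP/measurable_funM.
    apply: measurableT_comp; first exact: measurable_expR.
    apply: measurable_funD; first exact: measurableT_comp mF measurable_fst.
    apply: measurable_funM; first exact: measurable_snd.
    exact: measurableT_comp mZ measurable_fst.
  exact: measurableT_comp (measurable_normal_pdf _ _) measurable_snd.
pose h t : \bar R := (expR (s ^+ 2 / 2 * t ^+ 2) * normal_pdf 0 tau t)%:E.
have mh : measurable_fun setT h.
  apply/measurable_EFinP/measurable_funM; last exact: measurable_normal_pdf.
  apply: measurableT_comp; first exact: measurable_expR.
  by apply: measurable_funM => //; exact: measurable_funX.
have h0 t : setT t -> (0 <= h t)%E.
  by move=> _; rewrite lee_fin mulr_ge0 ?expR_ge0 ?normal_pdf_ge0.
have f0 z : (0 <= f z)%E by rewrite lee_fin mulr_ge0 ?expR_ge0 ?normal_pdf_ge0.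
have -> : (\int[nu]_x (expR (F x + a / (2 * s ^+ 2) * Z x ^+ 2))%:E =
    \int[nu]_x \int[leb]_t f (x, t))%E.
  apply: eq_integral => x _; rewrite /f /=.
  under eq_integral do rewrite expRD -mulrA EFinM.
  rewrite ge0_integralZl_EFin ?expR_ge0//; last 2 first.
  - by move=> t _; rewrite lee_fin mulr_ge0 ?expR_ge0 ?normal_pdf_ge0.
  - apply/measurable_EFinP/measurable_funM; last exact: measurable_normal_pdf.
    by apply: measurableT_comp => //; exact: measurable_funM.
  rewrite integral_expR_normal_pdf// -EFinM -expRD tau2.
  by congr (expR (_ + _))%:E; field.
rewrite (@fubini_tonelli _ _ _ _ _ nu leb)//.
apply: (@le_trans _ _ (\int[leb]_t
    (K%:E * h t))%E); last first.
  rewrite ge0_integralZl_EFin// /h integral_expR_sqr_normal_pdf// ?tau2.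
    by rewrite mulrCA divff ?mulr1// expf_neq0.
  by rewrite mulrCA divff ?mulr1// expf_neq0.
apply: ge0_le_integral => //.
- by move=> t _; apply: integral_ge0.
- exact: measurable_fun_fubini_tonelli_G.
- exact: emeasurable_funM.
- move=> t _; rewrite /f /=.
  under eq_integral do rewrite EFinM muleC.
  rewrite ge0_integralZl_EFin ?normal_pdf_ge0//; last first.
    apply/measurable_EFinP/measurableT_comp; first exact: measurable_expR.
    by apply: measurable_funD => //; exact: measurable_funM.
  rewrite -EFinM mulrA [leRHS]EFinM muleC.
  by rewrite lee_wpmul2r// lee_fin normal_pdf_ge0.
Qed.

(** Induction on the dimension, one coordinate at a time: each averaging adds a square to [F] and a
    factor to [K], which is why both are generalised. *)
Lemma gaussian_mixture (a : R) : 0 < a -> a < 1 ->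
  forall k (K : R) (F : T -> R) (Z : 'I_k -> T -> R), 0 <= K ->
  measurable_fun setT F -> (forall i, measurable_fun setT (Z i)) ->
  (forall theta : 'I_k -> R,
     \int[nu]_x (expR (F x + \sum_i theta i * Z i x))%:E <=
     (K * expR (s ^+ 2 / 2 * \sum_i theta i ^+ 2))%:E)%E ->
  (\int[nu]_x (expR (F x + a / (2 * s ^+ 2) * \sum_i Z i x ^+ 2))%:E <=
     (K * (Num.sqrt (1 - a))^-1 ^+ k)%:E)%E.
Proof.
move=> a0 a1; elim=> [|k IH] K F Z K0 mF mZ FZ.
  have := FZ (fun _ => 0); rewrite big_ord0 mulr0 expR0 expr0.
  under eq_integral do rewrite big_ord0.
  by under [X in _ -> (X <= _)%E]eq_integral do rewrite big_ord0 mulr0.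
have -> : K * (Num.sqrt (1 - a))^-1 ^+ k.+1 =
    K * (Num.sqrt (1 - a))^-1 * (Num.sqrt (1 - a))^-1 ^+ k.
  by rewrite exprS mulrA.
under eq_integral do rewrite big_ord_recl mulrDr addrA.
have mZ2 i : measurable_fun setT (fun x => a / (2 * s ^+ 2) * Z i x ^+ 2).
  by apply: measurable_funM => //; exact: measurable_funX.
apply: (IH _ (fun x => F x + a / (2 * s ^+ 2) * Z ord0 x ^+ 2)
  (fun i => Z (lift ord0 i))) => //.
- by rewrite mulr_ge0// invr_ge0 sqrtr_ge0.
- exact: measurable_funD.
move=> theta; rewrite mulrAC.
under eq_integral do rewrite addrAC.
(* The first coordinate is averaged while the linear form in the others sits in [F] and its Gaussian
   bound in [K]. *)
apply: (@gaussian_mixture1 _ _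
  (fun x => F x + \sum_i theta i * Z (lift ord0 i) x)) => //.
- by rewrite mulr_ge0 ?expR_ge0.
- apply: measurable_funD => //; apply: measurable_sum => i.
  exact: measurable_funM.
(* [th] is [theta] with [t] prepended as coordinate [ord0]. *)
move=> t; pose th i := if unlift ord0 i is Some j then theta j else t.
have := FZ th.
under eq_integral do (rewrite big_ord_recl /th unlift_none addrA addrAC;
  under eq_bigr do rewrite liftK).
rewrite big_ord_recl /th unlift_none.
under eq_bigr do rewrite liftK.
by rewrite mulrDr addrC expRD mulrA.
Qed.

Lemma measurable_norm2_ge (r : R) k (Z : T -> 'rV[R]_k) : 0 <= r ->
  (forall i, measurable_fun setT (fun x => Z x ord0 i)) ->
  measurable [set x | r <= norm2 (Z x)].
Proof.
move=> r0 mZ.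
have -> : [set x | r <= norm2 (Z x)] =
    setT `&` [set x | r ^+ 2 <= \sum_i Z x ord0 i ^+ 2].
  apply/seteqP; split => x /=.
    by rewrite -norm2_sqr ler_pXn2r// ?nnegrE// norm2_ge0.
  by rewrite -norm2_sqr ler_pXn2r// ?nnegrE ?norm2_ge0// => -[].
apply: measurable_fun_le => //.
by apply: measurable_sum => i; exact: measurable_funX.
Qed.

Lemma gaussian_mixture_tail (a r : R) k (Z : T -> 'rV[R]_k) : 0 < a -> a < 1 ->
  0 <= r -> (forall i, measurable_fun setT (fun x => Z x ord0 i)) ->
  (forall theta : 'I_k -> R,
     \int[nu]_x (expR (\sum_i theta i * Z x ord0 i))%:E <=
     (expR (s ^+ 2 / 2 * \sum_i theta i ^+ 2))%:E)%E ->
  (nu [set x | (r <= norm2 (Z x))%R] <=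
     ((Num.sqrt (1 - a))^-1 ^+ k * expR (- (a * r ^+ 2 / (2 * s ^+ 2))))%:E)%E.
Proof.
move=> a0 a1 r0 mZ subgauss; set b := a / (2 * s ^+ 2).
have b0 : 0 < b by rewrite divr_gt0 ?mulr_gt0 ?exprn_gt0.
have mN : measurable_fun setT (fun x => \sum_i Z x ord0 i ^+ 2).
  by apply: measurable_sum => i; exact: measurable_funX.
have := measurable_norm2_ge r0 mZ; set A := [set x | _] => mA.
have mE : measurable_fun setT
    (fun x => (expR (0 + b * \sum_i Z x ord0 i ^+ 2))%:E).
  apply/measurable_EFinP/measurableT_comp; first exact: measurable_expR.
  by apply: measurable_funD => //; exact: measurable_funM.
have moment : (\int[nu]_x (expR (0 + b * \sum_i Z x ord0 i ^+ 2))%:E <=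
    (1 * (Num.sqrt (1 - a))^-1 ^+ k)%:E)%E.
  apply: (@gaussian_mixture _ a0 a1 k 1 (fun _ => 0)
    (fun i x => Z x ord0 i)) => // theta.
  by under eq_integral do rewrite add0r; rewrite mul1r.
rewrite -[A]setIT -integral_indic//.
(* Markov's inequality: on the event [A] the integrand is at least 1. *)
apply: (@le_trans _ _ (\int[nu]_x ((expR (- (b * r ^+ 2)))%:E *
   (expR (0 + b * \sum_i Z x ord0 i ^+ 2))%:E))%E).
  apply: ge0_le_integral => //.
  - exact/measurable_EFinP.
  - exact: emeasurable_funM.
  move=> x _; rewrite -EFinM lee_fin -expRD indicE.
  have [|_] := boolP (x \in A); last exact: expR_ge0.
  rewrite inE /A/= => rx; rewrite -expR0 ler_expR add0r addrC subr_ge0.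
  by rewrite ler_pM2l// -norm2_sqr ler_pXn2r// ?nnegrE// norm2_ge0.
rewrite ge0_integralZl_EFin ?expR_ge0//.
have -> : a * r ^+ 2 / (2 * s ^+ 2) = b * r ^+ 2 by rewrite mulrAC.
rewrite [X in (_ <= X%:E)%E]mulrC EFinM lee_wpmul2l ?lee_fin ?expR_ge0//.
by rewrite mul1r in moment.
Qed.

End gaussian_mixture.

(** * Concentration of vector-valued Lipschitz maps *)

(** As [1 - (1 - v) ^+ 2 = v * (2 - v)], inverting and squaring reduce the claim to
    [v <= (2 - v) * (v + 2) ^+ 2]. *)
Lemma sqrtr_one_sub_inv_le (R : realType) (v : R) : 0 < v -> v < 1 ->
  (Num.sqrt (1 - (1 - v) ^+ 2))^-1 <= 1 + 2 / v.
Proof.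
move=> v0 v1.
have v_neq0 : v != 0 by rewrite gt_eqF.
have v2_gt0 : 0 < v + 2 by rewrite addr_gt0.
have yE : 1 + 2 / v = (v / (v + 2))^-1.
  by field; rewrite v_neq0 gt_eqF.
have q0 : 0 < 1 - (1 - v) ^+ 2 by nra.
rewrite yE lef_pV2 ?posrE ?sqrtr_gt0 ?divr_gt0//.
rewrite -(@ler_pXn2r _ 2)// ?nnegrE ?sqrtr_ge0 ?divr_ge0
  ?(ltW v0) ?(ltW v2_gt0)//.
rewrite sqr_sqrtr ?(ltW q0)// expr_div_n ler_pdivrMr ?exprn_gt0//.
have : v <= (2 - v) * (v + 2) ^+ 2 by nra.
move=> h; have -> : 1 - (1 - v) ^+ 2 = v * (2 - v) by ring.
by rewrite -mulrA expr2 ler_pM2l.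
Qed.

Lemma powR_half (R : realType) (k : nat) :
  (2 : R) `^ (k%:R / 2) = (Num.sqrt (1 - 2^-1))^-1 ^+ k.
Proof.
have -> : 1 - 2^-1 = 2^-1 :> R by lra.
rewrite sqrtrV// invrK -powR12_sqrt// -powR_mulrn ?powR_ge0//.
by rewrite -powRrM mulrC.
Qed.

Section vector_concentration.
Context {R : realType} {XX : pointedMetricType R} {k : nat} {Y : set 'rV[R]_k}.
Variables (nu : probability (borel XX) R) (sigma : R).
Hypothesis nu_moment : finite_first_moment nu.
Variables (f : XX -> euclidean_subspace Y) (L : R).
Hypothesis L_gt0 : 0 < L.
Hypothesis Lf : lipschitz_with L f.

(** Cauchy-Schwarz; the shift [c] cancels and later centres the functional. *)
Lemma lipschitz_functional (theta : 'I_k -> R) (c : R) :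
  lipschitz_real (norm2 (\row_i theta i) * L)
    (fun x => \sum_i theta i * vec (f x) ord0 i - c).
Proof.
move=> x y; rewrite opprB addrA subrK -sumrB.
have -> : \sum_i (theta i * vec (f x) ord0 i - theta i * vec (f y) ord0 i) =
    \sum_i (\row_i theta i) ord0 i * (vec (f x) - vec (f y)) ord0 i.
  by apply: eq_bigr => i _; rewrite !mxE mulrBr.
rewrite (le_trans (sum_mul_le_norm2 _ _))// -mulrA ler_wpM2l ?norm2_ge0//.
exact: Lf.
Qed.

Lemma lipschitz_coordinate (i : 'I_k) :
  lipschitz_real L (fun x => vec (f x) ord0 i).
Proof.
move=> x y; apply: le_trans (Lf x y).
have -> : vec (f x) ord0 i - vec (f y) ord0 i = (vec (f x) - vec (f y)) ord0 i.
  by rewrite !mxE.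
rewrite (le_trans (ler_norm _))// -sqrtr_sqr ler_wsqrtr//.
by rewrite (bigD1 i)//= lerDl sumr_ge0// => j _; exact: sqr_ge0.
Qed.

(** [fine] loses nothing here: Lipschitz coordinates are integrable, as [meanE] records. *)
Definition mean_vec : 'rV[R]_k :=
  map_mx fine (expectation_vec nu (fun x : borel XX => vec (f x))).
Local Notation m := mean_vec.

Let meanE (i : 'I_k) :
  (\int[nu]_x (vec (f x) ord0 i)%:E = (m ord0 i)%:E)%E.
Proof.
rewrite /mean_vec !mxE unlock fineK//.
apply: (integrable_fin_num measurableT).
exact: (lipschitz_integrable nu_moment (lipschitz_coordinate i)).
Qed.

Lemma measurable_centered (i : 'I_k) :
  measurable_fun setT (fun x : borel XX => (vec (f x) - m) ord0 i).
Proof.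
under eq_fun do rewrite mxE [X in _ + X]mxE.
apply: measurable_funB => //.
exact: lipschitz_borel_measurable (lipschitz_coordinate i).
Qed.

Hypothesis sigma_gt0 : 0 < sigma.
Hypothesis transport : forall mu : probability (borel XX) R,
  finite_first_moment mu ->
  (wasserstein1 mu nu <=
     sqrte ((2 * sigma ^+ 2)%:E * relative_entropy mu nu))%E.

(** The functional has mean zero and Lipschitz constant [|theta| * L], so [transport_mgf] leaves
    only the quadratic term. *)
Lemma centered_mgf (theta : 'I_k -> R) :
  (\int[nu]_x (expR (\sum_i theta i * (vec (f x) - m) ord0 i))%:E <=
     (expR ((sigma * L) ^+ 2 / 2 * \sum_i theta i ^+ 2))%:E)%E.
Proof.
pose c := \sum_i theta i * m ord0 i.
have sumE x : \sum_i theta i * (vec (f x) - m) ord0 i =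
    \sum_i theta i * vec (f x) ord0 i - c.
  by rewrite -sumrB; apply: eq_bigr => i _; rewrite !mxE mulrBr.
under eq_integral do rewrite sumE.
have normE : \sum_i theta i ^+ 2 = norm2 (\row_i theta i) ^+ 2.
  by rewrite norm2_sqr; apply: eq_bigr => i _; rewrite mxE.
(* [transport_mgf] wants a positive Lipschitz constant; for [theta = 0] both sides are 1. *)
have [n0|n_neq0] := eqVneq (norm2 (\row_i theta i)) 0.
  have th0 i : theta i = 0.
    by have := norm2_eq0 n0 => /rowP/(_ i); rewrite !mxE.
  under eq_integral do (rewrite /c -sumrB big1; last
    by move=> i _; rewrite th0 !mul0r subr0).
  rewrite expR0 integral_cst// [X in (_ * X)%E](@probability_setT _ _ _ nu).
  by rewrite mule1 normE n0 expr0n mulr0 expR0.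
have n_gt0 : 0 < norm2 (\row_i theta i) by rewrite lt0r n_neq0 norm2_ge0.
have iZ i : nu.-integrable setT
    (fun x : borel XX => (theta i * vec (f x) ord0 i)%:E).
  under eq_fun do rewrite EFinM.
  apply: integrableZl => //.
  exact: (lipschitz_integrable nu_moment (lipschitz_coordinate i)).
have iS : nu.-integrable setT
    (EFin \o (fun x : borel XX => \sum_i theta i * vec (f x) ord0 i)).
  rewrite (_ : _ \o _ = fun x : borel XX =>
    (\sum_i (theta i * vec (f x) ord0 i)%:E)%E); last first.
    by apply/funext => x /=; rewrite sumEFin.
  exact: integrable_sum.
have mean0 : \int[nu]_x (\sum_i theta i * vec (f x) ord0 i - c) = 0.
  rewrite RintegralB//; last exact: (finite_measure_integrable_cst nu c).
  rewrite Rintegral_cst// [X in _ * fine X]probability_setT mulr1.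
  apply/eqP; rewrite subr_eq0; apply/eqP; rewrite /Rintegral.
  under eq_integral do rewrite -sumEFin.
  rewrite integral_sum//.
  under eq_bigr => i _.
    under eq_integral do rewrite EFinM.
    rewrite integralZl//; last first.
      exact: (lipschitz_integrable nu_moment (lipschitz_coordinate i)).
    rewrite meanE -EFinM; over.
  by rewrite sumEFin.
have := transport_mgf nu_moment sigma_gt0 transport (mulr_gt0 n_gt0 L_gt0)
  (lipschitz_functional theta c).
rewrite mean0 add0r normE => /le_trans; apply.
by rewrite lee_fin ler_expR le_eqVlt; apply/orP; left; apply/eqP; field.
Qed.

Lemma lipschitz_tail (a r : R) : 0 < a -> a < 1 -> 0 <= r ->
  (nu [set x | (r <= norm2 (vec (f x) - m))%R] <=
     ((Num.sqrt (1 - a))^-1 ^+ k *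
        expR (- (a * r ^+ 2 / (2 * (sigma * L) ^+ 2))))%:E)%E.
Proof.
move=> a0 a1 r0; apply: gaussian_mixture_tail => //.
- exact: mulr_gt0.
- exact: measurable_centered.
- exact: centered_mgf.
Qed.

Lemma measurable_deviation (r : R) : 0 <= r ->
  measurable [set x : borel XX | r <= norm2 (vec (f x) - m)].
Proof.
by move=> r0; exact: measurable_norm2_ge measurable_centered.
Qed.

End vector_concentration.

Theorem theorem1 (R : realType) (XX : pointedMetricType R) (k : nat)
    (Y : set 'rV[R]_k)
    (hX : polish XX) (hk : (1 <= k)%N) (hY : polish (euclidean_subspace Y))
    (d : measure_display) (Omega : measurableType d) (P : probability Omega R)
    (X : {RV P >-> borel XX})
    (nu : probability (borel XX) R)
    (hlaw : forall A : set (borel XX), measurable A ->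
      distribution P X A = nu A)
    (hnu : finite_first_moment nu)
    (sigma : R) (hsigma : 0 < sigma)
    (hT1 : forall mu : probability (borel XX) R, finite_first_moment mu ->
      (wasserstein1 mu nu <=
         sqrte ((2 * sigma ^+ 2)%:E * relative_entropy mu nu))%E) :
  forall (eps : R) (veps : R) (f : XX -> euclidean_subspace Y) (L : R),
    0 < eps -> 0 < veps -> veps <= 1 ->
    lipschitz_with L f -> 0 < L ->
    (norm_max (expectation_vec nu (fun x : borel XX => vec (f x))) < +oo)%E ->
    let m : 'rV[R]_k :=
      map_mx fine (expectation_vec nu (fun x : borel XX => vec (f x))) in
    (P [set w | (eps <= norm2 (vec (f (X w)) - m))%R] <=
     (Num.min
       ((1 + 2 / veps) ^+ k *
          expR (- (eps ^+ 2 * (1 - veps) ^+ 2 / (2 * sigma ^+ 2 * L ^+ 2))))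
       (2 `^ (k%:R / 2) *
          expR (- (eps ^+ 2 / (4 * sigma ^+ 2 * L ^+ 2)))))%:E)%E.
Proof.
move=> eps veps f L eps0 v0 v1 Lf L0 _; lazy zeta.
rewrite -/(mean_vec nu f); set m := mean_vec nu f.
have mA : measurable [set x : borel XX | eps <= norm2 (vec (f x) - m)].
  exact: (measurable_deviation nu Lf (ltW eps0)).
(* The event is the preimage under [X] of a Borel set, so [hlaw] applies. *)
have -> : P [set w | eps <= norm2 (vec (f (X w)) - m)] =
    nu [set x : borel XX | eps <= norm2 (vec (f x) - m)].
  by rewrite -hlaw.
have tail a : 0 < a -> a < 1 ->
  (nu [set x | (eps <= norm2 (vec (f x) - m))%R] <=
    ((Num.sqrt (1 - a))^-1 ^+ k *
       expR (- (a * eps ^+ 2 / (2 * (sigma * L) ^+ 2))))%:E)%E.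
  move=> a0 a1.
  by apply: (lipschitz_tail hnu L0 Lf hsigma hT1) => //; exact: ltW.
have s_neq0 : sigma != 0 by rewrite gt_eqF.
have L_neq0 : L != 0 by rewrite gt_eqF.
rewrite EFin_min le_min; apply/andP; split; last first.
  rewrite powR_half; apply: le_trans (tail 2^-1 _ _) _; [lra|lra|].
  rewrite lee_fin le_eqVlt; apply/orP; left; apply/eqP; congr (_ * expR (- _)).
  by field; rewrite ?s_neq0 ?L_neq0.
(* At [veps = 1] the choice [a = (1 - veps) ^+ 2] would be 0, outside the range of [tail]; the bound
   is then [3 ^+ k >= 1]. *)
have [v_eq1|v_neq1] := eqVneq veps 1.
  apply: (@le_trans _ _ 1%E); first exact: probability_le1.
  rewrite v_eq1 subrr expr0n mulr0 mul0r oppr0 expR0 mulr1 lee_fin.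
  by rewrite exprn_ege1// divr1; lra.
have v_lt1 : veps < 1 by rewrite lt_neqAle v_neq1.
apply: le_trans (tail ((1 - veps) ^+ 2) _ _) _.
- by rewrite exprn_gt0// subr_gt0.
- by nra.
(* The exponential factors coincide, so only the constants differ. *)
rewrite lee_fin ler_pM ?expR_ge0 ?exprn_ge0 ?invr_ge0 ?sqrtr_ge0//.
  rewrite lerXn2r ?nnegrE ?invr_ge0 ?sqrtr_ge0//.
    by rewrite addr_ge0// divr_ge0// ltW.
  exact: sqrtr_one_sub_inv_le.
rewrite ler_expR le_eqVlt; apply/orP; left; apply/eqP; congr (- _).
by field; rewrite ?s_neq0 ?L_neq0.
Qed.
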